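(* Let $\eta\in\mathbb{R}$, $\lambda>-1/2$, $\beta>-1/2$, $d=\lambda+\beta+i\eta$, and let $\Phi_n$ be the monic orthogonal polynomials on the unit circle with respect to the weight function $$w(\theta)=e^{-\eta\theta}[\sin^2(\theta/2)]^{\lambda}[\cos^2(\theta/2)]^{\beta},\qquad 0\le\theta\le2\pi.$$ Then, for $n\ge1$, $\Phi_n$ and the reversed polynomial $\Phi_n^*$ satisfy $$\begin{aligned} z(z^2-1)\Phi_n''(z)&+[(d+3-n)z^2+2(\lambda-\beta)z+\overline d+n-1]\Phi_n'(z)\\ &-[n(d+2)z-(d+n+1)\ell_{n+1,n}-2n(\beta-\lambda)]\Phi_n(z)=-(d+n+1)\overline{\alpha}_n\Phi_n^*(z), \end{aligned}$$ and $$\begin{aligned} z(1-z^2)(\Phi_n^* )''(z)&-[(d+3-n)z^2+2(\lambda-\beta)z+\overline d+n-1](\Phi_n^* )'(z)\\ &+[d(n-2)z-2n(\beta-\lambda)-(d+n)\ell_{n,n-1}-\overline{\ell}_{n+1,n}-(\overline d+n)\alpha_n\overline{\alpha}_{n-1}]\Phi_n^*(z)\\ &=[2(d+n)\alpha_{n-1}z+(\overline d+n+1)\alpha_n]\Phi_n(z). \end{aligned}$$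
   Context: The monic orthogonal polynomials $\Phi_n$ ($\deg\Phi_n=n$) are orthogonal for $\langle f,g\rangle=\int_0^{2\pi}f(e^{i\theta})\overline{g(e^{i\theta})}\,w(\theta)\,d\theta$, and are written $\Phi_n(z)=z^n+\ell_{n,n-1}z^{n-1}+\cdots+\ell_{n,0}$. Reversed polynomial: $\Phi_n^*(z)=z^n\overline{\Phi_n(1/\overline z)}$. Verblunsky coefficients: $\alpha_{n-1}=-\overline{\Phi_n(0)}$ for $n\ge1$, and $\alpha_{-1}=-1$. Prime denotes $d/dz$. *)

(* Defs.v *)
From mathcomp Require Import all_boot all_order all_algebra.
From mathcomp Require Import all_classical all_reals all_analysis.
From mathcomp Require Import complex.

Set Implicit Arguments.
Unset Strict Implicit.
Unset Printing Implicit Defensive.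

Import Order.TTheory GRing.Theory Num.Theory.

Local Open Scope complex_scope.
Local Open Scope ring_scope.

Definition expi (R : realType) (theta : R) : R[i] := cos theta +i* sin theta.

Definition cintegral (R : realType) (D : set R) (f : R -> R[i]) : R[i] :=
  (\int[@lebesgue_measure R]_(x in D) complex.Re (f x))%R
  +i* (\int[@lebesgue_measure R]_(x in D) complex.Im (f x))%R.

Definition inner_uc (R : realType) (w : R -> R) (f g : R[i] -> R[i]) : R[i] :=
  cintegral `[0, 2 * pi]%classic
    (fun theta => f (expi theta) * (g (expi theta))^* * (w theta)%:C).

Definition is_monic_opuc (R : realType) (w : R -> R) (Phi : nat -> {poly R[i]})
    : Prop :=
  (forall n, size (Phi n) = n.+1 /\ Phi n \is monic) /\
  (forall m n, m != n -> inner_uc w (horner (Phi m)) (horner (Phi n)) = 0).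

(* powR gives the bases sin^2 and cos^2 the value 0 or 1 where they vanish; this
   happens only at theta = 0, pi, 2 pi, hence on a null set. *)
Definition jacobi_weight (R : realType) (eta lambda beta theta : R) : R :=
  expR (- eta * theta) * (sin (theta / 2) ^+ 2) `^ lambda
  * (cos (theta / 2) ^+ 2) `^ beta.

(* The reversal depends on the nominal degree n; revpE identifies it with
   z^n * conj (p (1 / conj z)), which determines the polynomial. *)
Definition revp (R : realType) (n : nat) (p : {poly R[i]}) : {poly R[i]} :=
  \poly_(k < n.+1) (p`_(n - k))^*.

Lemma revpE (R : realType) (n : nat) (p : {poly R[i]}) (z : R[i]) :
  (size p <= n.+1)%N -> z != 0 ->
  (revp n p).[z] = z ^+ n * (p.[1 / z^*])^*.
Proof.
move=> sp z0; rewrite horner_poly (horner_coef_wide _ sp) rmorph_sum mulr_sumr.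
rewrite (reindex_inj rev_ord_inj) /=; apply: eq_bigr => k _.
have kn : (k <= n)%N by rewrite -ltnS.
rewrite subSS subKn// rmorphM rmorphXn /= rmorphM /= rmorph1 mul1r fmorphV /= conjCK.
have -> : z ^+ n = z ^+ (n - k) * z ^+ k by rewrite -exprD subnK.
by rewrite exprVn mulrCA mulfK// expf_neq0.
Qed.

(* The conventional value alpha_(-1) = -1 is not represented. *)
Definition verblunsky (R : realType) (Phi : nat -> {poly R[i]}) (k : nat)
    : R[i] :=
  - ((Phi k.+1).[0])^*.

(* Main.v *)
Require Import Defs.
From HB Require Import structures.
From mathcomp Require Import all_boot all_order all_algebra.
From mathcomp Require Import all_classical all_reals all_analysis.
From mathcomp Require Import measurable_realfun complex ring lra zify.

Set Implicit Arguments.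
Unset Strict Implicit.
Unset Printing Implicit Defensive.

Import Order.TTheory GRing.Theory Num.Theory numFieldNormedType.Exports.

Local Open Scope complex_scope.
Local Open Scope ring_scope.

(* The weight satisfies the Pearson equation
   (z^2 - 1) dw/dtheta = i (d z^2 + 2 (lambda - beta) z + conj d) w, so that
   integrating d/dtheta [z^k (z^2 - 1) w] over the circle gives a three-term
   recurrence for the moments.  By two summations by parts, the second order
   operator on the left-hand sides maps Phi_n and Phi_n^* to polynomials which,
   up to explicit multiples of z Phi_n and z Phi_n^*, are orthogonal to
   z, ..., z^(n-1) and of degree at most n; hence they are combinations of Phi_n
   and Phi_n^*.  The coefficients are found by pairing with 1 and z^n and by the
   Szego recursion.  For Phi_n^* the constant term moreover gives
   Re ((d + n) ell_(n,n-1)) = n (lambda - beta) by induction on n. *)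

(** * Functionals on Laurent polynomials *)

Section MomentFunctional.
Variable R : realType.
Local Notation C := (complex R).
Implicit Types (c : int -> C) (p q : {poly C}) (m : int).

(* The value on z^(-m) p(z) of the functional on Laurent polynomials with
   moments c; for the moments of a weight it is the inner product <p, z^m>. *)
Definition mpair c m p : C := \sum_(i < size p) p`_i * c (i%:Z - m).

Definition mip c p q : C := \sum_(j < size q) (q`_j)^* * mpair c j p.

Lemma mpair_wide n c m p : (size p <= n)%N ->
  mpair c m p = \sum_(i < n) p`_i * c (i%:Z - m).
Proof.
move=> pn; rewrite /mpair (big_ord_widen n (fun i => p`_i * c (i%:Z - m)))//.
rewrite [RHS](bigID (fun i : 'I_n => (i < size p)%N)) /= [X in _ + X]big1 ?addr0//.
by move=> i; rewrite -leqNgt => /leq_sizeP/(_ _ (leqnn _)) ->; rewrite mul0r.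
Qed.

Lemma mip_wide n c p q : (size q <= n)%N ->
  mip c p q = \sum_(j < n) (q`_j)^* * mpair c j p.
Proof.
move=> qn; rewrite /mip (big_ord_widen n (fun j => (q`_j)^* * mpair c j p))//.
rewrite [RHS](bigID (fun i : 'I_n => (i < size q)%N)) /= [X in _ + X]big1 ?addr0//.
move=> i; rewrite -leqNgt => /leq_sizeP/(_ _ (leqnn _)) ->.
by rewrite rmorph0 mul0r.
Qed.

Lemma mpair_is_linear c m : scalar (mpair c m).
Proof.
move=> a p q; set n := maxn (size p) (size q).
have pn : (size p <= n)%N by rewrite leq_maxl.
have qn : (size q <= n)%N by rewrite leq_maxr.
rewrite !(@mpair_wide n)//; last first.
  by rewrite (leq_trans (size_polyD _ _))// geq_max (leq_trans (size_scale_leq _ _)).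
rewrite mulr_sumr -big_split; apply: eq_bigr => i _ /=.
by rewrite coefD coefZ mulrDl mulrA.
Qed.

HB.instance Definition _ c m :=
  GRing.isLinear.Build C {poly C} C *%R (mpair c m) (mpair_is_linear c m).

Lemma mpairZ c m a p : mpair c m (a *: p) = a * mpair c m p.
Proof. exact: linearZ. Qed.

Lemma mpairD c m p q : mpair c m (p + q) = mpair c m p + mpair c m q.
Proof. exact: linearD. Qed.

Lemma mpairXn c m n : mpair c m 'X^n = c (n%:Z - m).
Proof.
rewrite (@mpair_wide n.+1) ?size_polyXn// big_ord_recr/= coefXn eqxx mul1r.
rewrite big1 ?add0r// => i _.
by rewrite coefXn ltn_eqF// mul0r.
Qed.

Lemma mpairE c m p : mpair c m p = \sum_(i < size p) p`_i * mpair c m 'X^i.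
Proof. by apply: eq_bigr => i _; rewrite mpairXn. Qed.

Lemma mpairXM c m p : mpair c m ('X * p) = mpair c (m - 1) p.
Proof.
rewrite -[p in LHS]coefK poly_def mulr_sumr linear_sum [RHS]mpairE.
apply: eq_bigr => i _; rewrite -scalerAr linearZ /= -exprS !mpairXn.
by congr (_ * c _); lia.
Qed.

(** Reversal sends z^i to z^(n-i) and conjugates coefficients, so orthogonality of [p] to z^j
    becomes orthogonality of its reversal to z^(n-j). *)
Lemma mpair_revp c n m p : (forall k, c (- k) = (c k)^*) ->
  (size p <= n.+1)%N -> mpair c m (revp n p) = (mpair c (n%:Z - m) p)^*.
Proof.
move=> herm pn; rewrite (@mpair_wide n.+1) ?size_poly//.
rewrite (@mpair_wide n.+1)// rmorph_sum /= (reindex_inj rev_ord_inj) /=.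
apply: eq_bigr => i _; have il : (i <= n)%N by rewrite -ltnS.
rewrite coef_poly subSS ltnS leq_subr subKn// rmorphM /= -herm.
by congr (_ * c _); lia.
Qed.

(** Such a [p] pairs to zero with itself. The Szego recursion and both operator identities are
    obtained by applying this to the difference of two sides. *)
Lemma mip_eq0 c n p : (forall q, q != 0 -> mip c q q != 0) ->
  (size p <= n)%N -> (forall k, (k < n)%N -> mpair c k p = 0) -> p = 0.
Proof.
move=> pos pn orth; apply/eqP; apply/negPn/negP => /pos; rewrite (@mip_wide n)//.
by rewrite big1 ?eqxx// => i _; rewrite orth ?mulr0.
Qed.

End MomentFunctional.

(** * Functionals whose moments satisfy the Pearson recurrence *)

Section PearsonFunctional.
Variables (R : realType) (d mu : R[i]) (c : int -> R[i]).
Implicit Types (p : {poly R[i]}) (n : nat) (m k : int).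

Hypothesis pearson : forall k : int,
  (k%:~R + 2 + d) * c (k + 2) + 2 * mu * c (k + 1) + (d^* - k%:~R) * c k = 0.

(** By linearity it suffices to treat z^i, where this is the Pearson recurrence at k = i - m, solved
    for the terms with factor i. *)
Lemma mpair_deriv m p : mpair c m ('X * ('X^2 - 1) * p^`()) =
  - ((d + 2 - m%:~R) * mpair c (m - 2) p + 2 * mu * mpair c (m - 1) p
     + (d^* + m%:~R) * mpair c m p).
Proof.
have -> : mpair c m ('X * ('X^2 - 1) * p^`()) =
    \sum_(i < size p) p`_i * mpair c m ('X * ('X^2 - 1) * 'X^i^`()).
  rewrite -[p in p^`()]coefK poly_def raddf_sum mulr_sumr linear_sum /=.
  by apply: eq_bigr => i _; rewrite derivZ -scalerAr linearZ.
apply/eqP; rewrite -addr_eq0; apply/eqP.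
rewrite (mpairE c (m - 2)) (mpairE c (m - 1)) (mpairE c m p).
rewrite !mulr_sumr -!big_split big1// => i _ /=.
rewrite derivXn !mpairXn.
have -> : 'X * ('X^2 - 1) * ('X^(i.-1) *+ i) =
    i%:R *: ('X^(i + 2) - 'X^i) :> {poly R[i]}.
  case: (nat_of_ord i) => [|j] /=; first by rewrite mulr0n mulr0 scale0r.
  rewrite scaler_nat -[_ *+ _]mulr_natr -[in RHS]mulr_natr mulrA; congr (_ * _).
  by rewrite addn2 !exprS expr0; ring.
rewrite linearZ /= linearB /= !mpairXn.
have := pearson (i%:Z - m); rewrite rmorphB /= -pmulrn.
have -> : (i + 2)%:Z - m = i%:Z - m + 2 by lia.
have -> : i%:Z - (m - 2) = i%:Z - m + 2 by lia.
have -> : i%:Z - (m - 1) = i%:Z - m + 1 by lia.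
move=> e; transitivity (p`_i * 0); last by rewrite mulr0.
rewrite -e; ring.
Qed.

(** Up to sign, the second order operator shared by the two differential equations; [mu] stands for
    lambda - beta. *)
Definition pearson_op n p : {poly R[i]} :=
  'X * ('X^2 - 1) * p^`()^`()
  + ((d + 3 - n%:R) *: 'X^2 + (2 * mu) *: 'X + (d^* + n%:R - 1)%:P) * p^`().

(* Two summations by parts: the operator is z^(n-1) D (z^(1-n) p'), where D is
   annihilated by the functional. *)
Lemma mpair_pearson_op n m p : mpair c m (pearson_op n p) =
  (n%:R - 1 - m%:~R) * ((d + 1 - m%:~R) * mpair c (m - 1) p
    + 2 * mu * mpair c m p + (d^* + m%:~R + 1) * mpair c (m + 1) p).
Proof.
have := mpair_deriv (m + 1) p.
have -> : 'X * ('X^2 - 1) * p^`() = 'X * ('X * ('X * p^`()) - p^`()).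
  by rewrite expr2; ring.
rewrite mpairXM linearB /= !mpairXM => e.
have -> : mpair c m (pearson_op n p) = mpair c m ('X * ('X^2 - 1) * p^`()^`())
    + ((d + 3 - n%:R) * mpair c (m - 1 - 1) p^`()
       + 2 * mu * mpair c (m - 1) p^`() + (d^* + n%:R - 1) * mpair c m p^`()).
  rewrite /pearson_op mpairD; congr (_ + _).
  rewrite mulrDl mulrDl mul_polyC -!(@scalerAl _ {poly R[i]}) !mpairD.
  by rewrite !mpairZ expr2 -(@mulrA {poly R[i]}) !mpairXM.
move: e; have -> : m + 1 - 2 = m - 1 by lia.
have -> : m + 1 - 1 = m by lia.
rewrite mpair_deriv rmorphD /= mulr1z.
have -> : m - 1 - 1 = m - 2 by lia.
(* Applied to p', [mpair_deriv] cancels the terms in 2 mu and leaves the factor n - 1 - m in front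
   of the left side of [e]. *)
move=> e; transitivity (- (n%:R - 1 - m%:~R) *
  (mpair c (m - 2) p^`() - mpair c m p^`())); last by rewrite e; ring.
ring.
Qed.

Lemma coef0_pearson_op n p :
  (pearson_op n p)`_0 = (d^* + n%:R - 1) * p`_1.
Proof.
rewrite /pearson_op coefD -mulrA coefXM /= add0r coef0M !coefD !coefZ coefXn.
by rewrite coefX coefC coef_deriv /= !mulr0 !add0r mulr1n.
Qed.

Lemma coefS_pearson_op n p j : (pearson_op n p)`_j.+1 =
  j%:R * (d + 2 - n%:R + j%:R) * p`_j + 2 * mu * j.+1%:R * p`_j.+1
  + j.+2%:R * (d^* + n%:R - 2 - j%:R) * p`_j.+2.
Proof.
rewrite /pearson_op coefD -mulrA coefXM /= mulrBl mul1r coefB coefXnM.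
rewrite !(@mulrDl {poly R[i]}) !coefD -!(@scalerAl _ {poly R[i]}) !coefZ.
rewrite coefXnM coefXM coefCM.
rewrite /= !coef_deriv.
(* The shifts by X and X^2 cut off low coefficients, so j = 0 and j = 1 are checked separately. *)
case: j => [|[|j]] /=; rewrite ?subn2 /=; ring.
Qed.

End PearsonFunctional.

(** * Orthogonal polynomials of a Pearson functional *)

Section OrthogonalPolynomials.
Variables (R : realType) (d mu : R[i]) (c : int -> R[i]).
Hypothesis herm : forall k, c (- k) = (c k)^*.
Hypothesis pearson : forall k : int,
  (k%:~R + 2 + d) * c (k + 2) + 2 * mu * c (k + 1) + (d^* - k%:~R) * c k = 0.
Hypothesis pos : forall p, p != 0 -> mip c p p != 0.
Variable P : nat -> {poly R[i]}.
Hypothesis size_P : forall n, size (P n) = n.+1.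
Hypothesis monic_P : forall n, P n \is monic.
Hypothesis orth_P : forall m n, m != n -> mip c (P m) (P n) = 0.
Implicit Types n k : nat.

(** The squared norm of [P n]: as [P n] is monic and orthogonal to lower powers, pairing with z^n
    equals pairing with itself. *)
Local Notation N n := (mpair c n (P n)).
Local Notation Ps n := (revp n (P n)).
Local Notation ell n := ((P n)`_n.-1).
Local Notation alpha := (verblunsky P).

Let lead_P n : (P n)`_n = 1.
Proof. by have /monicP := monic_P n; rewrite lead_coefE size_P. Qed.

Let coef_P_gt n k : (n < k)%N -> (P n)`_k = 0.
Proof. by move=> nk; rewrite nth_default ?size_P. Qed.

(** Strong induction on k: in the orthogonality of [P n] to [P k] only the leading term of [P k] is
    left. *)
Lemma mpair_P_lt n k : (k < n)%N -> mpair c k (P n) = 0.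
Proof.
elim/ltn_ind: k => k IH kn.
have := orth_P (negbT (gtn_eqF kn)).
rewrite (@mip_wide _ k.+1) ?size_P// big_ord_recr /= lead_P rmorph1 mul1r.
by rewrite big1 ?add0r// => j _; rewrite IH ?mulr0// (ltn_trans _ kn).
Qed.

Lemma mpair_P_neq0 n : N n != 0.
Proof.
have := pos (_ : P n != 0); rewrite (@mip_wide _ n.+1) ?size_P//.
rewrite big_ord_recr /= lead_P rmorph1 mul1r big1 ?add0r; last first.
  by move=> j _; rewrite mpair_P_lt ?mulr0.
by apply; rewrite -size_poly_eq0 size_P.
Qed.

(** In the orthogonality of [P n] to [P n.+1] only the two top coefficients of [P n.+1]
    contribute. *)
Lemma mpair_P_next n : mpair c n.+1 (P n) = - (ell n.+1)^* * N n.
Proof.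
apply/eqP; rewrite mulNr -addr_eq0; apply/eqP.
have := orth_P (negbT (ltn_eqF (ltnSn n))).
rewrite (@mip_wide _ n.+2) ?size_P// 2!big_ord_recr /= lead_P rmorph1 mul1r.
rewrite big1 ?add0r; first by rewrite addrC.
by move=> j _; rewrite mpair_P_lt ?mulr0.
Qed.

Let mpair_Ps n m : mpair c m (Ps n) = (mpair c (n%:Z - m) (P n))^*.
Proof. by rewrite mpair_revp ?size_P. Qed.

Lemma mpair_Ps_eq0 n k : (0 < k <= n)%N -> mpair c k (Ps n) = 0.
Proof.
case/andP=> k0 kn; rewrite mpair_Ps subzn// mpair_P_lt ?rmorph0//.
by rewrite ltn_subrL k0 (leq_trans k0 kn).
Qed.

Lemma mpair_Ps0 n : mpair c 0 (Ps n) = (N n)^*.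
Proof. by rewrite mpair_Ps subr0. Qed.

Let coef_Ps n k : (k <= n)%N -> (Ps n)`_k = ((P n)`_(n - k))^*.
Proof. by move=> kn; rewrite coef_poly ltnS kn. Qed.

Let coef_Ps_gt n k : (n < k)%N -> (Ps n)`_k = 0.
Proof. by move=> nk; rewrite coef_poly ltnS leqNgt nk. Qed.

Let lead_Ps n : (Ps n.+1)`_n.+1 = - alpha n.
Proof. by rewrite coef_Ps// subnn /verblunsky horner_coef0 opprK. Qed.

(** Both sides have degree at most n and are orthogonal to z, ..., z^n, so they are proportional;
    pairing with 1 gives the factor [a], and the constant terms identify it. *)
Theorem szego n : 'X * P n - P n.+1 = (alpha n)^* *: Ps n.
Proof.
set a := mpair c (-1) (P n) / (N n)^*.
have Nn0 : (N n)^* != 0 by rewrite conjC_eq0 mpair_P_neq0.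
have E : 'X * P n - P n.+1 = a *: Ps n.
  apply/eqP; rewrite -subr_eq0; apply/eqP.
  apply: (mip_eq0 (n := n.+1) pos) => [|k].
    apply/leq_sizeP => j nj; rewrite !coefB coefZ coefXM.
    case: j nj => // j nj /=; rewrite coef_Ps_gt// mulr0 subr0.
    move: nj; rewrite ltnS leq_eqVlt => /predU1P[<-|nj].
      by rewrite !lead_P subrr.
    by rewrite !coef_P_gt ?subrr.
  rewrite ltnS => kn.
  rewrite mpairD mpairD -scaleN1r -[- (a *: _)]scaleN1r !mpairZ mpairXM.
  rewrite (@mpair_P_lt n.+1)// mulr0 addr0.
  case: k kn => [_|k kn]; last first.
    rewrite mpair_Ps_eq0// !mulr0 addr0 -addn1 PoszD addrK.
    by rewrite mpair_P_lt.
  by rewrite mpair_Ps0 /a mulfVK// mulN1r sub0r subrr.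
rewrite E; congr (_ *: _); have := congr1 (fun p : {poly R[i]} => p`_0) E.
rewrite coefB coefXM coefZ /= coef_Ps// subn0 lead_P rmorph1 mulr1 sub0r => <-.
by rewrite /verblunsky rmorphN /= conjCK horner_coef0.
Qed.

Lemma mpair_P_pred n : mpair c (-1) (P n) = (alpha n)^* * (N n)^*.
Proof.
have := congr1 (mpair c 0) (szego n).
rewrite mpairD -scaleN1r !mpairZ mpairXM mpair_Ps0 (@mpair_P_lt n.+1)//.
by rewrite mulr0 addr0 sub0r.
Qed.

(** Compares coefficients of z^(n+1) in the Szego recursion for [P n.+2]. *)
Lemma ell_rec n :
  ell n.+2 = ell n.+1 + (alpha n.+1)^* * alpha n.
Proof.
have := congr1 (fun p : {poly R[i]} => p`_n.+1) (szego n.+1).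
rewrite coefB coefXM coefZ /= lead_Ps => /eqP.
by rewrite subr_eq mulrN addrC -subr_eq opprK => /eqP ->.
Qed.

Lemma mpair_Ps_pred n : mpair c (-1) (Ps n) = - ell n.+1 * (N n)^*.
Proof.
rewrite mpair_Ps (_ : n%:Z - -1 = n.+1%:Z); last by lia.
by rewrite mpair_P_next rmorphM rmorphN /= conjCK.
Qed.

Lemma mpair_Ps_next n : mpair c n.+1 (Ps n) = alpha n * N n.
Proof.
rewrite mpair_Ps (_ : n%:Z - n.+1%:Z = -1); last by lia.
by rewrite mpair_P_pred rmorphM /= !conjCK.
Qed.

(** The multiple of ['X * P n.+1] removes degree n+2; that of [P n.+1] removes degree n+1, by
    [ell_rec]. The rest is orthogonal to z, ..., z^n, and pairing with 1 fixes the factor of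
    [Ps n.+1]. *)
Theorem pearson_op_P n (a := d + n.+1%:R + 1) :
  pearson_op d mu n.+1 (P n.+1) - (n.+1%:R * (d + 2)) *: ('X * P n.+1)
  + (a * ell n.+2 - 2 * n.+1%:R * mu) *: P n.+1
  = - (a * (alpha n.+1)^*) *: Ps n.+1.
Proof.
apply/eqP; rewrite -subr_eq0 -!(@scaleNr _ {poly R[i]}); apply/eqP.
apply: (mip_eq0 (n := n.+1) pos) => [|k kn].
  apply/leq_sizeP => -[|j]//; rewrite ltnS => nj.
  rewrite 3!coefD !coefZ coefS_pearson_op coefXM /= (@coef_P_gt _ j.+2)//.
  move: nj; rewrite leq_eqVlt => /predU1P[<-{j}|].
    by rewrite lead_P lead_Ps (ell_rec n) /a /=; ring.
  rewrite leq_eqVlt => /predU1P[<-{j}|nj].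
    by rewrite (@coef_P_gt _ n.+2)// coef_Ps_gt// lead_P; ring.
  have nj' : (n.+1 < j.+1)%N by exact: ltnW.
  by rewrite (coef_P_gt nj) (coef_P_gt nj') (coef_Ps_gt nj'); ring.
rewrite 3!mpairD !mpairZ mpair_pearson_op// mpairXM mpair_P_lt//.
(* The pairing with z^(k+1) drops out: by orthogonality for k < n, and because the factor n - k
   vanishes for k = n. *)
have -> : (n.+1%:R - 1 - k%:~R) * ((d + 1 - k%:~R) * mpair c (k%:Z - 1) (P n.+1)
    + 2 * mu * 0 + (d^* + k%:~R + 1) * mpair c (k%:Z + 1) (P n.+1)) =
    (n.+1%:R - 1 - k%:R) * (d + 1 - k%:R) * mpair c (k%:Z - 1) (P n.+1).
  move: kn; rewrite ltnS leq_eqVlt -pmulrn => /predU1P[->|kn].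
    by rewrite -natr1; ring.
  have -> : k%:Z + 1 = k.+1%:Z by lia.
  by rewrite mpair_P_lt//; ring.
case: k kn => [_|k kn].
  by rewrite sub0r mpair_P_pred mpair_Ps0 /a; ring.
have -> : k.+1%:Z - 1 = k%:Z by lia.
by rewrite mpair_P_lt ?mpair_Ps_eq0 ?(ltnW kn)//; ring.
Qed.

(* The coefficients are forced by pairing with 1 and z^n; comparing constant
   terms afterwards yields ell_real_part. *)
Lemma pearson_op_Ps_aux n (a := d + n.+1%:R) :
  pearson_op d mu n.+1 (Ps n.+1) - (d * (n.+1%:R - 2)) *: ('X * Ps n.+1)
  + (2 * a * alpha n) *: ('X * P n.+1)
  + ((d^* + n.+1%:R + 1) * alpha n.+1) *: P n.+1
  + ((a - 1) * ell n.+2 - 2 * n%:R * mu - 2 * a * alpha n * (alpha n.+1)^*)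
    *: Ps n.+1 = 0.
Proof.
rewrite -!(@scaleNr _ {poly R[i]}); apply: (mip_eq0 (n := n.+2) pos) => [|k kn].
  apply/leq_sizeP => -[|j]//; rewrite ltnS => nj.
  rewrite 4!coefD !coefZ coefS_pearson_op !coefXM /= !(@coef_Ps_gt _ j.+1)//.
  rewrite (@coef_Ps_gt _ j.+2) ?(@coef_P_gt _ j.+1)//; last by lia.
  (* Degree n+2 fixes the factor 2 [a] alpha_n of ['X * P n.+1]. *)
  move: nj; rewrite leq_eqVlt => /predU1P[<-{j}|nj].
    by rewrite lead_P lead_Ps /a; ring.
  by rewrite (coef_P_gt nj) (coef_Ps_gt nj); ring.
rewrite 4!mpairD !mpairZ mpair_pearson_op// !mpairXM.
(* These terms cancel on their own: they are nonzero only at k = n+1, which fixes the factor of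
   [P n.+1]. *)
have Ek : (n.+1%:R - 1 - k%:~R) * ((d^* + k%:~R + 1) * mpair c (k%:Z + 1) (Ps n.+1))
    + (d^* + n.+1%:R + 1) * alpha n.+1 * mpair c k (P n.+1) = 0.
  have -> : k%:Z + 1 = k.+1%:Z by lia.
  move: kn; rewrite -pmulrn ltnS leq_eqVlt => /predU1P[->|kn].
    by rewrite mpair_Ps_next; ring.
  by rewrite mpair_Ps_eq0 ?mpair_P_lt//; ring.
suff E : (n.+1%:R - 1 - k%:~R) * ((d + 1 - k%:~R) * mpair c (k%:Z - 1) (Ps n.+1)
      + 2 * mu * mpair c k (Ps n.+1))
    - d * (n.+1%:R - 2) * mpair c (k%:Z - 1) (Ps n.+1)
    + 2 * a * alpha n * mpair c (k%:Z - 1) (P n.+1)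
    + ((a - 1) * ell n.+2 - 2 * n%:R * mu - 2 * a * alpha n * (alpha n.+1)^*)
      * mpair c k (Ps n.+1) = 0.
  by have E0 := congr2 +%R E Ek; rewrite addr0 in E0; rewrite -[RHS]E0; ring.
rewrite -pmulrn.
(* k = 0 fixes the factor of [Ps n.+1]. At k = 1 the shift by z pairs [Ps n.+1] with 1, which fixes
   d (n.+1 - 2). For larger k every term vanishes. *)
case: k kn {Ek} => [_|k kn].
  by rewrite sub0r mpair_P_pred mpair_Ps0 mpair_Ps_pred /a; ring.
have -> : k.+1%:Z - 1 = k%:Z by lia.
rewrite (@mpair_Ps_eq0 _ k.+1)// (@mpair_P_lt _ k)//.
case: k kn => [_|k kn]; first by rewrite mpair_Ps0; ring.
by rewrite mpair_Ps_eq0; [ring|rewrite /= ltnW].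
Qed.

(** Induction on n. The base case is the Pearson recurrence at k = -1, with c(1) and c(-1) expressed
    by the constant term of [P 1]. The step compares constant terms in [pearson_op_Ps_aux]. *)
Lemma ell_real_part n (x := (d + n.+1%:R) * ell n.+1) :
  x + x^* = 2 * n.+1%:R * mu.
Proof.
rewrite /x {x}; elim: n => [|n IH].
  have c0 : (c 0)^* = c 0 by rewrite -herm oppr0.
  have N0 : c 0 != 0.
    have := mpair_P_neq0 0; rewrite (@mpair_wide _ 1) ?size_P//.
    by rewrite big_ord1 /= lead_P mul1r.
  have e : c 1 = - (P 1)`_0 * c 0.
    have := mpair_P_lt (ltnSn 0); rewrite (@mpair_wide _ 2) ?size_P//.
    rewrite 2!big_ord_recr big_ord0 /= lead_P mul1r add0r !subr0 => /eqP.
    by rewrite addrC addr_eq0 mulNr => /eqP.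
  have e' : c (-1) = - ((P 1)`_0)^* * c 0.
    by rewrite herm e rmorphM rmorphN /= c0.
  apply: (mulIf N0); have := pearson (-1).
  rewrite (_ : -1 + 2 = 1 :> int)// (_ : -1 + 1 = 0 :> int)// e e' => E.
  rewrite -[LHS]addr0 -[X in _ + X = _]E rmorphM rmorphD /= rmorph1 /=.
  rewrite rmorphN1; ring.
have := congr1 (fun p : {poly R[i]} => p`_0) (pearson_op_Ps_aux n).
rewrite -!(@scaleNr _ {poly R[i]}) 4!coefD !coefZ !coefXM /= coef0_pearson_op coef0.
rewrite !coef_Ps// subn1 subn0 lead_P rmorph1 /=.
have -> : (P n.+1)`_0 = - (alpha n)^*.
  by rewrite /verblunsky rmorphN /= conjCK opprK horner_coef0.
have es := ell_rec n.
have es' : (ell n.+2)^* = (ell n.+1)^* + alpha n.+1 * (alpha n)^*.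
  by rewrite es rmorphD rmorphM /= conjCK.
move: IH; rewrite !rmorphM !rmorphD /= !rmorph_nat rmorph1 es' es /= => IH E.
(* Writing 2 (n+2) mu this way uses the induction hypothesis twice and matches the term 2 n mu of
   [E]. *)
transitivity (2 * (2 * n.+1%:R * mu) - 2 * n%:R * mu); last by ring.
rewrite -IH -[LHS]addr0 -[X in _ + X = _]E; ring.
Qed.

(** This is [pearson_op_Ps_aux] with the factor of [Ps n.+1] rewritten: the constant term expresses
    that factor through conjugates, and [ell_real_part] gives the stated form. *)
Theorem pearson_op_Ps n :
  - pearson_op d mu n.+1 (Ps n.+1) + (d * (n.+1%:R - 2)) *: ('X * Ps n.+1)
  + (2 * n.+1%:R * mu - (d + n.+1%:R) * ell n.+1 - (ell n.+2)^*
     - (d^* + n.+1%:R) * alpha n.+1 * (alpha n)^*) *: Ps n.+1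
  = (2 * (d + n.+1%:R) * alpha n) *: ('X * P n.+1)
    + ((d^* + n.+1%:R + 1) * alpha n.+1) *: P n.+1.
Proof.
have E := pearson_op_Ps_aux n.
have := congr1 (fun p : {poly R[i]} => p`_0) E.
rewrite -!(@scaleNr _ {poly R[i]}) 4!coefD !coefZ !coefXM coef0_pearson_op coef0.
rewrite !coef_Ps// subn1 subn0 lead_P rmorph1 !mulr0 !addr0 mulr1.
have -> : (P n.+1)`_0 = - (alpha n)^*.
  by rewrite /verblunsky rmorphN /= conjCK opprK horner_coef0.
have := ell_real_part n; rewrite /= rmorphM rmorphD /= rmorph_nat => r e.
have -> : (ell n.+2)^* = (ell n.+1)^* + alpha n.+1 * (alpha n)^*.
  by rewrite ell_rec rmorphD rmorphM /= conjCK.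
set b := (X in _ + X = 0) in e; set a := (X in X *: Ps n.+1) in |- *.
have -> : a = - b.
  by rewrite /a -r -[LHS]subr0 -[X in _ - X = _]e; ring.
rewrite scaleNr -[LHS]addr0 -[X in _ + X = _]E -/b; ring.
Qed.

End OrthogonalPolynomials.

(** * The Jacobi weight *)

Section ImproperFTC.
Local Open Scope classical_set_scope.
Variable R : realType.
Local Notation mu := (@lebesgue_measure R).
Implicit Types (F f : R -> R) (a b M : R).

(* F(x) - \int_a^x f is continuous on [a, b] and has derivative 0 inside. *)
Lemma Rintegral_deriv_integrable F f a b : a < b -> continuous F ->
  (forall x, x \in `]a, b[%R -> is_derive x 1 F (f x)) ->
  (forall x, x \in `]a, b[%R -> {for x, continuous f}) ->
  mu.-integrable `[a, b] (EFin \o f) ->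
  \int[mu]_(x in `[a, b]) f x = F b - F a.
Proof.
move=> ab cF dF cf fi; pose G x := \int[mu]_(t in `[a, x]) f t.
have cG := parameterized_integral_continuous (ltW ab) fi.
have dG x : x \in `]a, b[%R -> is_derive x 1 G (f x).
  rewrite in_itv /= => /andP[ax xb].
  have [|dG <-] := @continuous_FTC1_closed R f a x b xb fi ax.
  - by apply: cf; rewrite in_itv /= ax.
  - by rewrite derive1E; exact: derivableP.
have cH : {within `[a, b], continuous (fun x => F x - G x)}.
  move=> x; apply: cvgB; [exact: continuous_subspaceT|exact: cG].
have [x xab|c _] := @MVT R (fun x => F x - G x) (fun=> 0) a b ab _ cH.
  have := dF x xab; have := dG x xab => dGx dFx.
  by apply: is_derive_eq; rewrite subrr.
rewrite mul0r /G set_itv1 Rintegral_set1 subr0 => /eqP.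
by rewrite subr_eq0 subr_eq addrC -subr_eq => /eqP <-.
Qed.

(** Monotone convergence along closed subintervals exhausting ]a, b[: on each, the integral is a
    difference of two values of [F], hence at most 2 M. *)
Lemma integrable_deriv_ge0 F f a b M : a < b -> (forall x, `|F x| <= M) ->
  (forall x, x \in `]a, b[%R -> is_derive x 1 F (f x)) ->
  (forall x, x \in `]a, b[%R -> {for x, continuous f}) ->
  (forall x, x \in `]a, b[%R -> 0 <= f x) ->
  mu.-integrable `]a, b[ (EFin \o f).
Proof.
move=> ab FM dF cf f0.
have mf : measurable_fun `]a, b[ f.
  apply: open_continuous_measurable_fun; first exact: interval_open.
  by move=> x; rewrite inE => /cf.
apply/integrableP; split; first exact/measurable_EFinP.
(* The denominator n + 3 keeps e_n at most (b - a) / 3, so that all subintervals are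
   nondegenerate. *)
pose e n : R := (b - a) / n.+3%:R.
have e0 n : 0 < e n by rewrite divr_gt0 ?subr_gt0.
have e3 n : e n <= (b - a) / 3.
  by rewrite ler_pM2l ?subr_gt0// lef_pV2 ?posrE// ler_nat.
pose A n : set R := `[a + e n, b - e n].
have Ab n : a + e n < b - e n by have := e3 n; have := ab; lra.
have AE : \bigcup_n A n = `]a, b[.
  apply/seteqP; split => x /=.
    move=> [n _]; rewrite /A /= !in_itv /= => /andP[ax xb].
    by apply/andP; split; have := e0 n; lra.
  rewrite in_itv /= => /andP[ax xb].
  have d0 : 0 < Num.min (x - a) (b - x) by rewrite lt_min !subr_gt0 ax.
  have [n nP] : exists n, e n <= Num.min (x - a) (b - x).
    exists (Num.truncn ((b - a) / Num.min (x - a) (b - x))).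
    rewrite ler_pdivrMr// -ler_pdivrMl// mulrC ltW//.
    apply: (lt_trans (truncnS_gt _)); rewrite ltr_nat//.
  exists n => //=; move: nP; rewrite /A /= in_itv /= le_min => /andP[? ?].
  by apply/andP; split; lra.
have Asub n : A n `<=` `]a, b[ by rewrite -AE; exact: bigcup_sup.
have mA n : measurable (A n) by exact: measurable_itv.
have AS : {homo A : n m / (n <= m)%N >-> (n <= m)%O}.
  move=> n m nm; rewrite subsetEset => x; rewrite /A /= !in_itv /=.
  have : e m <= e n.
    by rewrite ler_pM2l ?subr_gt0// lef_pV2 ?posrE// ler_nat !ltnS.
  by move=> ? /andP[? ?]; apply/andP; split; lra.
have mfA n : measurable_fun (A n) (abse \o (EFin \o f)).
  apply: measurable_funS (Asub n) _ => //.
  by apply: measurableT_comp => //; exact/measurable_EFinP.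
have := @ge0_nondecreasing_set_cvg_integral _ (measurableTypeR R) R A
  (abse \o (EFin \o f)) mu
  AS mA mfA (fun _ _ _ => abse_ge0 _).
rewrite AE => /cvge_to_le H; apply: (@le_lt_trans _ _ (2 * M)%:E).
  apply: H; apply: nearW => n.
  have -> : (\int[mu]_(x in A n) (abse \o (EFin \o f)) x =
      \int[mu]_(x in A n) (f x)%:E)%E.
    apply: eq_integral => x; rewrite inE => /Asub /= xab.
    by rewrite ger0_norm ?f0.
  rewrite (@continuous_FTC2 _ _ F)//.
  - by rewrite -EFinB lee_fin; have := FM (a + e n); have := FM (b - e n);
      rewrite !ler_norml => /andP[? ?] /andP[? ?]; lra.
  - apply: continuous_in_subspaceT => x; rewrite inE => /Asub; exact: cf.
  - have dF' x : A n x -> derivable F x 1.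
      by move=> /Asub xab; by have [] := dF x xab.
    have cF' x : A n x -> {for x, continuous F}.
      by move=> /dF' dFx; apply: differentiable_continuous; exact/derivable1_diffP.
    split.
    + by move=> x /subset_itv_oo_cc xA; apply: dF'.
    + apply: cvg_at_right_filter; apply: cF'.
      by rewrite /A /= in_itv /= lexx ltW.
    + apply: cvg_at_left_filter; apply: cF'.
      by rewrite /A /= in_itv /= lexx ltW.
  - move=> x /subset_itv_oo_cc/Asub xab; rewrite derive1E.
    by have [] := dF x xab.
by rewrite ltry.
Qed.

End ImproperFTC.

(** * Real powers of nonnegative functions *)

Section PowerFunction.
Local Open Scope classical_set_scope.
Variable R : realType.
Implicit Types (g : R -> R) (p x y : R).

Lemma is_derive_powR g p x dg : 0 < g x -> is_derive x 1 g dg ->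
  is_derive x 1 (fun y => g y `^ p) (p * g x `^ (p - 1) * dg).
Proof.
move=> gx0 dgx; apply: (@is_derive1_comp _ (fun y => y `^ p) g) dgx.
have gx : g x \in `]0, +oo[%R by rewrite in_itv /= gx0.
rewrite -(powR_derive1 p gx) derive1E; exact/derivableP/derivable_powR.
Qed.

Lemma is_derive_continuous g x dg : is_derive x 1 g dg -> {for x, continuous g}.
Proof. by move=> [dgx _]; apply: differentiable_continuous; exact/derivable1_diffP. Qed.

(** At a zero of [g] the power need not be differentiable; there g(y) < e^(1/p) gives g(y)^p < e
    directly. *)
Lemma continuous_powR g p : 0 < p -> (forall x, 0 <= g x) -> continuous g ->
  continuous (fun x => g x `^ p).
Proof.
move=> p0 g0 cg x; have := g0 x; rewrite le_eqVlt => /predU1P[gx0|gx0].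
  rewrite /continuous_at -gx0 powR0 ?gt_eqF//; apply/cvgr0Pnorm_lt => e e0.
  have e1 : 0 < e `^ p^-1 by rewrite powR_gt0.
  have := cg x; rewrite /continuous_at -gx0 => /cvgr0Pnorm_lt/(_ _ e1).
  apply: filterS => y; rewrite !ger0_norm ?powR_ge0// => gy.
  have -> : e = (e `^ p^-1) `^ p by rewrite -powRrM mulVf ?gt_eqF// powRr1// ltW.
  by apply: gt0_ltr_powR; rewrite ?nnegrE ?powR_ge0.
apply: (@continuous_comp _ _ _ g (fun y => y `^ p)); first exact: cg.
have gx : g x \in `]0, +oo[%R by rewrite in_itv /= gx0.
apply: differentiable_continuous; apply/derivable1_diffP.
exact: derivable_powR.
Qed.

(** The power is at most 1 for p >= 0 and at most its value at 1/2 for p < 0; the sum covers both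
    signs. *)
Lemma powR_half_le p x : 1 / 2 <= x <= 1 -> x `^ p <= 1 + (1 / 2) `^ p.
Proof.
move=> /andP[hx x1]; have x0 : 0 < x by lra.
have h0 : 0 < (1 / 2 : R) by lra.
have [p0|p0] := leP 0 p.
  rewrite (le_trans (y := 1)) ?lerDl ?powR_ge0//.
  rewrite [leRHS](_ : 1 = 1 `^ p); last by rewrite powR1.
  by rewrite ge0_ler_powR// nnegrE ltW.
rewrite (le_trans (y := (1 / 2) `^ p)) ?lerDr//.
rewrite -[p]opprK !(powRN _ (- p)) lef_pV2 ?posrE ?powR_gt0//.
by apply: ge0_ler_powR => //; rewrite ?nnegrE ?oppr_ge0; exact: ltW.
Qed.

End PowerFunction.

(** * Pearson equation, integrability and integration by parts for the weight *)

Section JacobiWeight.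
Local Open Scope classical_set_scope.
Variables (R : realType) (eta lambda beta : R).
Hypotheses (hlambda : - (1 / 2) < lambda) (hbeta : - (1 / 2) < beta).
Local Notation mu := (@lebesgue_measure R).
Local Notation w := (jacobi_weight eta lambda beta).
Local Notation u t := (sin (t / 2) ^+ 2).
Local Notation v t := (cos (t / 2) ^+ 2).
Implicit Types t x : R.

Let sin_half t : sin t = 2 * sin (t / 2) * cos (t / 2).
Proof. by rewrite [in LHS](splitr t) sinD; ring. Qed.

Let cos_half t : cos t = v t - u t.
Proof. by rewrite [in LHS](splitr t) cosD; ring. Qed.

Let uv t : u t + v t = 1.
Proof. by rewrite addrC cos2Dsin2. Qed.

Let sin_neq0 t : sin t != 0 -> (0 < u t) /\ (0 < v t).
Proof.
rewrite sin_half !mulf_eq0 !negb_or => /andP[/andP[_ s0] c0].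
by rewrite !exprn_even_gt0.
Qed.

Let derive_u t : is_derive t 1 (fun t => u t) (sin t / 2).
Proof.
have H : is_derive t 1 (fun t : R => t / 2) (1 / 2).
  by apply: is_derive_eq; rewrite !scaler0 add0r [LHS]mulr1 mul1r.
have H2 : is_derive t 1 (fun t => sin (t / 2)) (cos (t / 2) * (1 / 2)).
  exact: (@is_derive1_comp _ (@sin R) (fun t => t / 2) t _ _ (is_derive_sin _) H).
by apply: is_derive_eq; rewrite (sin_half t) /GRing.scale /=; field.
Qed.

Let derive_v t : is_derive t 1 (fun t => v t) (- sin t / 2).
Proof.
have -> : (fun t => v t) = (fun t => 1 - u t) by apply/funext => x; have := uv x; lra.
by have := derive_u t => H; apply: is_derive_eq; rewrite add0r mul1r mulNr.
Qed.

Let derive_expR t :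
  is_derive t 1 (fun x => expR (- eta * x)) (expR (- eta * t) * - eta).
Proof.
have H : is_derive t 1 (fun x : R => - eta * x) (- eta).
  by apply: is_derive_eq; rewrite /GRing.scale /=; ring.
exact: (@is_derive1_comp _ (@expR R) (fun x => - eta * x) t _ _
  (is_derive_expR _) H).
Qed.

Let continuous_u : continuous (fun t => u t).
Proof. by move=> t; exact: is_derive_continuous (derive_u t). Qed.

Let continuous_v : continuous (fun t => v t).
Proof. by move=> t; exact: is_derive_continuous (derive_v t). Qed.

Lemma jacobi_weight_ge0 t : 0 <= w t.
Proof. by rewrite /jacobi_weight !mulr_ge0 ?expR_ge0 ?powR_ge0. Qed.

Lemma jacobi_weight_gt0 t : sin t != 0 -> 0 < w t.
Proof.
by move=> /sin_neq0[u0 v0]; rewrite /jacobi_weight !mulr_gt0 ?expR_gt0 ?powR_gt0.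
Qed.

Let powR_pred x p : 0 < x -> x `^ p = x * x `^ (p - 1).
Proof.
move=> x0; rewrite [in LHS](_ : p = 1 + (p - 1)); last by ring.
rewrite (@powRD _ _ 1); last by apply/implyP => _; rewrite gt_eqF.
by rewrite powRr1// ltW.
Qed.

Lemma continuous_jacobi_weight t : sin t != 0 -> {for t, continuous w}.
Proof.
move=> /sin_neq0[u0 v0].
have Hu := @is_derive_powR _ (fun t => u t) lambda t _ u0 (derive_u t).
have Hv := @is_derive_powR _ (fun t => v t) beta t _ v0 (derive_v t).
have He := derive_expR t.
by apply: (is_derive_continuous (dg := _)); rewrite /jacobi_weight.
Qed.

(** The Pearson equation in real form: as z^2 - 1 = 2 i z sin t, it reads sin t w' = (- eta sin t +
    (lambda - beta) + (lambda + beta) cos t) w. *)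
Lemma is_derive_sin_jacobi_weight t : sin t != 0 ->
  is_derive t 1 (fun x => sin x * w x)
    ((cos t - eta * sin t + (lambda - beta) + (lambda + beta) * cos t) * w t).
Proof.
move=> /sin_neq0[u0 v0].
have He := derive_expR t.
have Hu := @is_derive_powR _ (fun t => u t) lambda t _ u0 (derive_u t).
have Hv := @is_derive_powR _ (fun t => v t) beta t _ v0 (derive_v t).
rewrite /jacobi_weight; apply: is_derive_eq.
rewrite /GRing.scale /= (powR_pred lambda u0) (powR_pred beta v0) (cos_half t).
have SS : sin t * sin t = 4 * u t * v t by rewrite (sin_half t); ring.
move: (uv t) SS; move: (sin t) (u t) (v t) (expR _) => S x y E.
move: (x `^ _) (y `^ _) => a b xy SS.
(* The difference is a combination of the relations sin^2 t = 4 u v and u + v = 1. *)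
apply/eqP; rewrite -subr_eq0; apply/eqP.
transitivity (E * a * b * ((lambda * y / 2 - beta * x / 2) * (S * S - 4 * x * y)
  + x * y * (lambda - beta) * (x + y - 1))); first by field.
by rewrite xy SS !subrr !mulr0 addr0 mulr0.
Qed.

Let abs_sin t : `|sin t| = 2 * (u t `^ (1 / 2) * v t `^ (1 / 2)).
Proof.
by rewrite !div1r !powR12_sqrt ?sqr_ge0// !sqrtr_sqr (sin_half t) !normrM
  ger0_norm// mulrA.
Qed.

(* The vanishing of sin absorbs the singularities because both exponents exceed
   -1/2; in particular integration by parts leaves no boundary terms. *)
Lemma continuous_sin_jacobi_weight : continuous (fun t => sin t * w t).
Proof.
pose Q t := 2 * expR (- eta * t) *
  (u t `^ (lambda + 1 / 2) * v t `^ (beta + 1 / 2)).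
have wQ t : `|sin t * w t| = Q t.
  rewrite normrM (ger0_norm (jacobi_weight_ge0 t)) abs_sin /Q /jacobi_weight.
  rewrite !powRD; [ring|..]; apply/implyP => /eqP ?; exfalso; move: hlambda hbeta; lra.
have cQ : continuous Q.
  move=> t; apply: cvgM; first apply: cvgM; first exact: cvg_cst.
    apply: (@continuous_comp _ _ _ (fun t => - eta * t) (@expR R)).
      by apply: cvgM; [exact: cvg_cst|exact: cvg_id].
    exact: continuous_expR.
  apply: cvgM.
    apply: (@continuous_powR _ (fun t => u t)) => //; last by move=> x; exact: sqr_ge0.
    by move: hlambda; lra.
  apply: (@continuous_powR _ (fun t => v t)) => //; last by move=> x; exact: sqr_ge0.
  by move: hbeta; lra.
(* Where sin t = 0 the modulus equals [Q], which is continuous and vanishes there. *)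
move=> t; have [st0|/is_derive_sin_jacobi_weight] := eqVneq (sin t) 0; last first.
  exact: is_derive_continuous.
rewrite /continuous_at st0 mul0r; apply/norm_cvg0P.
under eq_fun do rewrite wQ.
have := cQ t; rewrite /continuous_at.
by rewrite (_ : Q t = 0) // -wQ st0 mul0r normr0.
Qed.

(* Near its singularities the weight is dominated by the derivative of this
   bounded function, which is monotone on [0, pi] and on [pi, 2 pi]. *)
Let primitive t := u t `^ (lambda + 1 / 2) - v t `^ (beta + 1 / 2).

Let dprimitive t := sin t / 2 * ((lambda + 1 / 2) * u t `^ (lambda - 1 / 2)
  + (beta + 1 / 2) * v t `^ (beta - 1 / 2)).

Let primitive_bound t : `|primitive t| <= 1.
Proof.
have u0 : 0 <= u t by exact: sqr_ge0.
have v0 : 0 <= v t by exact: sqr_ge0.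
have le1 x p : 0 < p -> 0 <= x <= 1 -> x `^ p <= 1.
  move=> p0 /andP[x0 x1]; rewrite [leRHS](_ : 1 = 1 `^ p); last by rewrite powR1.
  by rewrite ge0_ler_powR ?nnegrE// ltW.
have u1 : u t `^ (lambda + 1 / 2) <= 1.
  by apply: le1; [move: hlambda; lra|have := uv t; rewrite u0 /=; lra].
have v1 : v t `^ (beta + 1 / 2) <= 1.
  by apply: le1; [move: hbeta; lra|have := uv t; rewrite v0 /=; lra].
have := powR_ge0 (u t) (lambda + 1 / 2); have := powR_ge0 (v t) (beta + 1 / 2).
by rewrite ler_norml /primitive => ? ?; apply/andP; split; lra.
Qed.

Let is_derive_primitive t : sin t != 0 -> is_derive t 1 primitive (dprimitive t).
Proof.
move=> /sin_neq0[u0 v0].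
have Hu := @is_derive_powR _ (fun t => u t) (lambda + 1 / 2) t _ u0 (derive_u t).
have Hv := @is_derive_powR _ (fun t => v t) (beta + 1 / 2) t _ v0 (derive_v t).
rewrite /primitive; apply: is_derive_eq.
have h2 x : x + 1 / 2 - 1 = x - 1 / 2 by lra.
by rewrite !h2 /dprimitive; field.
Qed.

Let continuous_dprimitive t : sin t != 0 -> {for t, continuous dprimitive}.
Proof.
move=> /sin_neq0[u0 v0].
have Hu := @is_derive_powR _ (fun t => u t) (lambda - 1 / 2) t _ u0 (derive_u t).
have Hv := @is_derive_powR _ (fun t => v t) (beta - 1 / 2) t _ v0 (derive_v t).
by apply: (is_derive_continuous (dg := _)); rewrite /dprimitive.
Qed.

(** Either u or v is at least 1/2. If it is u, then u^lambda is bounded and |sin(t/2)| >= 1/2, so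
    the term of |[dprimitive]| in v^beta dominates the weight; the other case is symmetric. *)
Let jacobi_weight_bound : exists C : R, forall t, `|t| <= 2 * pi -> sin t != 0 ->
  w t <= C * `|dprimitive t|.
Proof.
pose E := expR (`|eta| * (2 * pi)).
(* [E] bounds the exponential, the middle factor comes from [powR_half_le], and the last undoes beta
   + 1/2 and the lower bound 1/2 for |sin(t/2)|. *)
pose C1 := E * (1 + (1 / 2) `^ lambda) * (2 / (beta + 1 / 2)).
pose C2 := E * (1 + (1 / 2) `^ beta) * (2 / (lambda + 1 / 2)).
have b0 : 0 < beta + 1 / 2 by move: hbeta; lra.
have l0 : 0 < lambda + 1 / 2 by move: hlambda; lra.
have E0 : 0 < E by exact: expR_gt0.
have C10 : 0 <= C1.
  by rewrite /C1 !mulr_ge0 ?addr_ge0 ?powR_ge0 ?invr_ge0// ltW.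
have C20 : 0 <= C2.
  by rewrite /C2 !mulr_ge0 ?addr_ge0 ?powR_ge0 ?invr_ge0// ltW.
exists (C1 + C2) => t tpi /sin_neq0[u0 v0].
have D : `|dprimitive t| = (lambda + 1 / 2) * u t `^ lambda * `|cos (t / 2)|
    + (beta + 1 / 2) * v t `^ beta * `|sin (t / 2)|.
  have su : u t `^ lambda = u t `^ (lambda - 1 / 2) * `|sin (t / 2)|.
    rewrite -sqrtr_sqr -powR12_sqrt ?sqr_ge0// -powRD; last first.
      by apply/implyP => _; rewrite gt_eqF.
    by congr (_ `^ _); lra.
  have cv : v t `^ beta = v t `^ (beta - 1 / 2) * `|cos (t / 2)|.
    rewrite -sqrtr_sqr -powR12_sqrt ?sqr_ge0// -powRD; last first.
      by apply/implyP => _; rewrite gt_eqF.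
    by congr (_ `^ _); lra.
  rewrite /dprimitive su cv normrM (ger0_norm (x := _ + _)); last first.
    by rewrite addr_ge0// mulr_ge0 ?powR_ge0// ltW.
  rewrite (_ : sin t / 2 = sin (t / 2) * cos (t / 2)); last first.
    by rewrite (sin_half t); field.
  by rewrite normrM; ring.
have Et : expR (- eta * t) <= E.
  rewrite ler_expR (le_trans (ler_norm _))// normrM normrN.
  by rewrite ler_wpM2l.
have half (x : R) : 1 / 2 <= x ^+ 2 -> 1 / 2 <= `|x|.
  by rewrite -real_normK ?num_real// => ?; have := normr_ge0 x; nra.
have T1 : 0 <= (lambda + 1 / 2) * u t `^ lambda * `|cos (t / 2)|.
  by rewrite !mulr_ge0 ?powR_ge0// ltW.
have T2 : 0 <= (beta + 1 / 2) * v t `^ beta * `|sin (t / 2)|.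
  by rewrite !mulr_ge0 ?powR_ge0// ltW.
rewrite D /jacobi_weight.
have [uh|uh] := leP (1 / 2) (u t).
  apply: (@le_trans _ _ (C1 * ((beta + 1 / 2) * v t `^ beta * `|sin (t / 2)|))).
    apply: (@le_trans _ _ (E * (1 + (1 / 2) `^ lambda) * v t `^ beta)).
      rewrite ler_wpM2r ?powR_ge0// ler_pM ?expR_ge0 ?powR_ge0//.
      by apply: powR_half_le; rewrite uh /=; have := uv t; lra.
    have -> : C1 * ((beta + 1 / 2) * v t `^ beta * `|sin (t / 2)|) =
        E * (1 + (1 / 2) `^ lambda) * v t `^ beta * (2 * `|sin (t / 2)|).
      by rewrite /C1; field; rewrite gt_eqF// ; lra.
    rewrite ler_peMr ?mulr_ge0 ?addr_ge0 ?powR_ge0//; first exact: ltW.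
    by have := half _ uh; lra.
  by rewrite ler_pM ?lerDl ?lerDr.
have vh : 1 / 2 <= v t by have := uv t; lra.
apply: (@le_trans _ _ (C2 * ((lambda + 1 / 2) * u t `^ lambda * `|cos (t / 2)|))).
  apply: (@le_trans _ _ (E * u t `^ lambda * (1 + (1 / 2) `^ beta))).
    rewrite ler_pM ?mulr_ge0 ?expR_ge0 ?powR_ge0 ?ler_wpM2r ?powR_ge0//.
    by apply: powR_half_le; rewrite vh /=; have := uv t; lra.
  have -> : C2 * ((lambda + 1 / 2) * u t `^ lambda * `|cos (t / 2)|) =
      E * u t `^ lambda * (1 + (1 / 2) `^ beta) * (2 * `|cos (t / 2)|).
    by rewrite /C2; field; rewrite gt_eqF// ; lra.
  rewrite ler_peMr ?mulr_ge0 ?addr_ge0 ?powR_ge0//; first exact: ltW.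
  by have := half _ vh; lra.
by rewrite ler_pM ?lerDl ?lerDr.
Qed.

Let sin_gt0 t : t \in `]0, pi[%R -> 0 < sin t.
Proof. by rewrite in_itv /=; exact: sin_gt0_pi. Qed.

Let sin_lt0 t : t \in `]pi, 2 * pi[%R -> sin t < 0.
Proof.
rewrite in_itv /= => /andP[? ?]; rewrite -[t](subrK pi) sinDpi oppr_lt0.
by apply: sin_gt0_pi; apply/andP; split; lra.
Qed.

Lemma measurable_jacobi_weight : measurable_fun [set: R] w.
Proof.
apply: measurable_funM; first apply: measurable_funM.
- apply: measurableT_comp; first exact: measurable_expR.
  by apply: measurable_funM => //.
- apply: (measurableT_comp (measurable_powR lambda)).
  exact: continuous_measurable_fun continuous_u.
- apply: (measurableT_comp (measurable_powR beta)).
  exact: continuous_measurable_fun continuous_v.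
Qed.

(** Here [h] is meant to be [dprimitive] or its opposite, whichever is nonnegative on [D]. *)
Let integrable_jacobi_weight_dom (D : set (measurableTypeR R)) (h : R -> R) :
  measurable D -> (forall t, D t -> `|t| <= 2 * pi) -> (forall t, D t -> sin t != 0) ->
  (forall t, `|h t| = `|dprimitive t|) -> mu.-integrable D (EFin \o h) ->
  mu.-integrable D (EFin \o w).
Proof.
move=> mD D2pi Dsin hd hi; have [C wC] := jacobi_weight_bound.
have Ci := integrableZl mD C hi; apply: (le_integrable mD _ _ Ci).
  by apply/measurable_EFinP; exact: measurable_funS measurable_jacobi_weight.
move=> t Dt; rewrite /= lee_fin ger0_norm ?jacobi_weight_ge0// normrM hd.
by rewrite (le_trans (wC _ (D2pi _ Dt) (Dsin _ Dt)))// ler_wpM2r// ler_norm.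
Qed.

Let dprimitive_ge0 t : 0 <= sin t -> 0 <= dprimitive t.
Proof.
move=> st; rewrite mulr_ge0 ?divr_ge0// addr_ge0// mulr_ge0 ?powR_ge0//.
- by move: hlambda; lra.
- by move: hbeta; lra.
Qed.

Let dprimitive_le0 t : sin t <= 0 -> dprimitive t <= 0.
Proof.
move=> st; rewrite mulr_le0_ge0 ?addr_ge0 ?mulr_ge0 ?powR_ge0//.
- by rewrite pmulr_lle0.
- by move: hlambda; lra.
- by move: hbeta; lra.
Qed.

(** Split at pi, where [primitive] changes from increasing to decreasing; endpoints are null
    sets. *)
Lemma integrable_jacobi_weight : mu.-integrable `[0, 2 * pi] (EFin \o w).
Proof.
have pi0 := pi_gt0 R.
have J1 : mu.-integrable `]0, pi[ (EFin \o w).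
  apply: (@integrable_jacobi_weight_dom _ dprimitive) => //.
  - by move=> t; rewrite /= in_itv /= => /andP[? ?]; rewrite ger0_norm; lra.
  - by move=> t /= /sin_gt0 t0; rewrite gt_eqF.
  - apply: (@integrable_deriv_ge0 _ primitive _ _ _ 1) => // t /sin_gt0 t0.
    + by apply: is_derive_primitive; rewrite gt_eqF.
    + by apply: continuous_dprimitive; rewrite gt_eqF.
    + exact/dprimitive_ge0/ltW.
have J2 : mu.-integrable `]pi, 2 * pi[ (EFin \o w).
  apply: (@integrable_jacobi_weight_dom _ (\- dprimitive)) => //.
  - by move=> t; rewrite /= in_itv /= => /andP[? ?]; rewrite ger0_norm; lra.
  - by move=> t /= /sin_lt0 t0; rewrite lt_eqF.
  - by move=> t /=; rewrite normrN.
  - apply: (@integrable_deriv_ge0 _ (\- primitive) _ _ _ 1).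
    + by move: pi0; lra.
    + by move=> x /=; rewrite normrN.
    + move=> t /sin_lt0 t0; apply: is_deriveN.
      by apply: is_derive_primitive; rewrite lt_eqF.
    + move=> t /sin_lt0 t0; apply: cvgN.
      by apply: continuous_dprimitive; rewrite lt_eqF.
    + by move=> t /sin_lt0 t0 /=; rewrite oppr_ge0; exact/dprimitive_le0/ltW.
have mw D : measurable D -> measurable_fun D (abse \o (EFin \o w)).
  move=> mD; apply: measurableT_comp => //; apply/measurable_EFinP.
  exact: measurable_funS measurable_jacobi_weight.
apply/integrableP; split.
  by apply/measurable_EFinP; exact: measurable_funS measurable_jacobi_weight.
move: J1 J2 => /integrableP[_ J1] /integrableP[_ J2].
rewrite (@itv_bndbnd_setU _ _ (BLeft 0) (BRight pi)); first last.
- by rewrite bnd_simp; move: pi0; lra.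
- by rewrite bnd_simp ltW.
rewrite ge0_integral_setU//=; first last.
- by rewrite disj_set2E; apply/eqP/seteqP; split => // t /=; rewrite !in_itv /=; lra.
- by apply: mw; exact: measurableU.
rewrite integral_itv_bndoo; last exact: mw.
rewrite [X in (_ + X)%E]integral_itv_bndoo; last exact: mw.
exact: lte_add_pinfty.
Qed.

Lemma integrable_continuous_mul_jacobi_weight (g : R -> R) : continuous g ->
  mu.-integrable `[0, 2 * pi] (EFin \o (fun t => g t * w t)).
Proof.
move=> cg; have mg : measurable_fun `[0, 2 * pi] g.
  by apply: measurable_funS (continuous_measurable_fun cg).
apply: (@integrableMr _ (measurableTypeR R) R mu _ (measurable_itv _) g _ mg
  _ integrable_jacobi_weight).
have [M [_ mrt]] := compact_bounded
  (continuous_compact (continuous_subspaceT cg) (@segment_compact R 0 (2 * pi))).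
by exists M; split; rewrite ?num_real // => x Mx y ty /=; apply: mrt => //; exists y.
Qed.

Lemma continuous_parts_integrand (e de : R -> R) : continuous e -> continuous de ->
  continuous (fun t => de t * sin t + e t * (cos t - eta * sin t
    + (lambda - beta) + (lambda + beta) * cos t)).
Proof.
move=> ce cde t; have cs := @continuous_sin R; have cc := @continuous_cos R.
apply: cvgD; first by apply: cvgM; [exact: cde|exact: cs].
apply: cvgM; first exact: ce.
apply: cvgD; last by apply: cvgM; [exact: cvg_cst|exact: cc].
apply: cvgD; last exact: cvg_cst.
apply: cvgB; first exact: cc.
by apply: cvgM; [exact: cvg_cst|exact: cs].
Qed.

(** The integrand is the derivative of e sin t w away from the zeros of sin. That product is
    continuous and vanishes at 0, pi and 2 pi, so each half contributes 0. *)
Lemma Rintegral_jacobi_weight_by_parts (e de : R -> R) :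
  (forall t, is_derive t 1 e (de t)) -> continuous de ->
  \int[mu]_(t in `[0, 2 * pi]) ((de t * sin t + e t * (cos t - eta * sin t
    + (lambda - beta) + (lambda + beta) * cos t)) * w t) = 0.
Proof.
move=> dee cde; have pi0 := pi_gt0 R.
have ce : continuous e by move=> t; exact: is_derive_continuous (dee t).
pose g t := de t * sin t + e t * (cos t - eta * sin t
    + (lambda - beta) + (lambda + beta) * cos t).
have cg : continuous g by exact: continuous_parts_integrand.
have gi := integrable_continuous_mul_jacobi_weight cg.
pose F t := e t * (sin t * w t).
have cF : continuous F.
  by move=> t; apply: cvgM; [exact: ce|exact: continuous_sin_jacobi_weight].
have dF t : sin t != 0 -> is_derive t 1 F (g t * w t).
  move=> /is_derive_sin_jacobi_weight dw; have det := dee t.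
  apply: is_derive_eq; rewrite /GRing.scale /= /g; ring.
have cgw t : sin t != 0 -> {for t, continuous (fun t => g t * w t)}.
  by move=> st0; apply: cvgM; [exact: cg|exact: continuous_jacobi_weight].
have gi1 : mu.-integrable `[0, pi] (EFin \o (fun t => g t * w t)).
  apply: integrableS gi => // t /=; rewrite !in_itv /= => /andP[? ?].
  by apply/andP; split; lra.
have gi2 : mu.-integrable `[pi, 2 * pi] (EFin \o (fun t => g t * w t)).
  apply: integrableS gi => // t /=; rewrite !in_itv /= => /andP[? ?].
  by apply/andP; split; lra.
have pi2 : pi < 2 * pi :> R by move: pi0; lra.
have I1 : \int[mu]_(t in `[0, pi]) (g t * w t) = 0.
  have D t : t \in `]0, pi[%R -> is_derive t 1 F (g t * w t).
    by move=> /sin_gt0 t0; apply: dF; rewrite gt_eqF.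
  have D' t : t \in `]0, pi[%R -> {for t, continuous (fun t => g t * w t)}.
    by move=> /sin_gt0 t0; apply: cgw; rewrite gt_eqF.
  rewrite (Rintegral_deriv_integrable pi0 cF D D' gi1).
  by rewrite /F sinpi sin0 !mul0r !mulr0 subrr.
have I2 : \int[mu]_(t in `[pi, 2 * pi]) (g t * w t) = 0.
  have D t : t \in `]pi, 2 * pi[%R -> is_derive t 1 F (g t * w t).
    by move=> /sin_lt0 t0; apply: dF; rewrite lt_eqF.
  have D' t : t \in `]pi, 2 * pi[%R -> {for t, continuous (fun t => g t * w t)}.
    by move=> /sin_lt0 t0; apply: cgw; rewrite lt_eqF.
  rewrite (Rintegral_deriv_integrable pi2 cF D D' gi2).
  by rewrite /F sinpi mulr_natl sin2pi !mul0r !mulr0 subrr.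
have := @Rintegral_itvB R (fun t => g t * w t) (BLeft 0) (BRight (2 * pi)) pi gi.
rewrite I1 subr0 !bnd_simp => -> //.
- rewrite Rintegral_itv_obnd_cbnd//; apply: integrableS gi2 => // t /=.
  by rewrite !in_itv /= => /andP[? ?]; apply/andP; split; lra.
- by move: pi0; lra.
- by move: pi0; lra.
Qed.

End JacobiWeight.

(** * Moments of a weight on the circle *)

Section Cis.
Variable R : realType.
Implicit Types (k : int) (t : R).

(** The power z^k of z = [expi t], written so that k may be negative. *)
Definition cis k t : R[i] := cos (k%:~R * t) +i* sin (k%:~R * t).

Lemma cisD k l t : cis (k + l) t = cis k t * cis l t.
Proof.
apply/eqP; rewrite eq_complex /= rmorphD mulrDl cosD sinD.
by rewrite eqxx /= addrC eqxx.
Qed.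

Lemma cisN k t : cis (- k) t = (cis k t)^*.
Proof. by apply/eqP; rewrite eq_complex /= rmorphN mulNr cosN sinN !eqxx. Qed.

Lemma expi_exp t n : expi t ^+ n = cis n t.
Proof.
elim: n => [|n IH].
  by rewrite expr0 /cis mul0r cos0 sin0.
by rewrite exprS IH intS cisD; congr (_ * _); rewrite /cis mul1r.
Qed.

End Cis.

Section WeightMoments.
Local Open Scope classical_set_scope.
Variables (R : realType) (w : R -> R).
Local Notation mu := (@lebesgue_measure R).
Local Notation C := (complex R).
Hypothesis wi : forall g : R -> R, continuous g ->
  mu.-integrable `[0, 2 * pi] (EFin \o (fun t => g t * w t)).
Implicit Types (f g : R -> C) (p q : {poly C}) (k : int).

Definition wint f : C := cintegral `[0, 2 * pi] (fun t => f t * (w t)%:C).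

Definition moment k : C := wint (cis k).

(** Componentwise, because [cintegral] integrates real and imaginary parts separately. *)
Definition ccontinuous f :=
  continuous (fun t => complex.Re (f t)) /\ continuous (fun t => complex.Im (f t)).

Lemma wintE f : wint f =
  (\int[mu]_(t in `[0, 2 * pi]) (complex.Re (f t) * w t))
  +i* (\int[mu]_(t in `[0, 2 * pi]) (complex.Im (f t) * w t)).
Proof.
rewrite /wint /cintegral; congr (_ +i* _); apply: eq_Rintegral => t _.
  by case: (f t) => a b /=; rewrite mulr0 subr0.
by case: (f t) => a b /=; rewrite mulr0 add0r.
Qed.

Lemma ccontinuousD f g : ccontinuous f -> ccontinuous g ->
  ccontinuous (fun t => f t + g t).
Proof.
move=> [f1 f2] [g1 g2]; split => t.
  rewrite (_ : (fun t => _) = (fun t => complex.Re (f t) + complex.Re (g t))).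
    by apply: cvgD; [exact: f1|exact: g1].
  by apply/funext => x; case: (f x) => ? ?; case: (g x).
rewrite (_ : (fun t => _) = (fun t => complex.Im (f t) + complex.Im (g t))).
  by apply: cvgD; [exact: f2|exact: g2].
by apply/funext => x; case: (f x) => ? ?; case: (g x).
Qed.

Lemma ccontinuousZ a f : ccontinuous f -> ccontinuous (fun t => a * f t).
Proof.
move=> [f1 f2]; split => t; case: a => a b.
  rewrite (_ : (fun t => _) = (fun t => a * complex.Re (f t) - b * complex.Im (f t))).
    by apply: cvgB; apply: cvgM; (try exact: cvg_cst); [exact: f1|exact: f2].
  by apply/funext => x; case: (f x) => ? ?.
rewrite (_ : (fun t => _) = (fun t => a * complex.Im (f t) + b * complex.Re (f t))).
  by apply: cvgD; apply: cvgM; (try exact: cvg_cst); [exact: f2|exact: f1].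
by apply/funext => x; case: (f x) => ? ?.
Qed.

Lemma ccontinuous_cis k : ccontinuous (cis k).
Proof.
have ck : continuous (fun t : R => k%:~R * t).
  by move=> t; apply: cvgM; [exact: cvg_cst|exact: cvg_id].
split=> t /=.
  by apply: (@continuous_comp _ _ _ _ (@cos R)); [exact: ck|exact: continuous_cos].
by apply: (@continuous_comp _ _ _ _ (@sin R)); [exact: ck|exact: continuous_sin].
Qed.

Lemma ccontinuous_sum (I : Type) (r : seq I) (F : I -> R -> C) :
  (forall i, ccontinuous (F i)) -> ccontinuous (fun t => \sum_(i <- r) F i t).
Proof.
move=> cF; elim: r => [|i r IH].
  by split=> t; (under eq_fun do rewrite big_nil); exact: cvg_cst.
under eq_fun do rewrite big_cons.
exact: ccontinuousD.
Qed.

Lemma wintD f g : ccontinuous f -> ccontinuous g ->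
  wint (fun t => f t + g t) = wint f + wint g.
Proof.
move=> [f1 f2] [g1 g2]; rewrite !wintE; apply/eqP; rewrite eq_complex /=.
rewrite -!RintegralD//; try exact: wi.
apply/andP; split; apply/eqP; apply: eq_Rintegral => t _.
  by case: (f t) => ? ?; case: (g t) => ? ? /=; ring.
by case: (f t) => ? ?; case: (g t) => ? ? /=; ring.
Qed.

Lemma wintZ a f : ccontinuous f -> wint (fun t => a * f t) = a * wint f.
Proof.
move=> [f1 f2]; rewrite !wintE; case: a => a b; apply/eqP; rewrite eq_complex /=.
have wZ (x : R) (h : R -> R) : continuous h ->
    mu.-integrable `[0, 2 * pi] (EFin \o (fun t => x * (h t * w t))).
  by move=> ch;
    exact: (@integrableZl _ (measurableTypeR R) R mu _ (measurable_itv _) x _ (wi ch)).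
rewrite -!RintegralZl//; try exact: wi.
rewrite -RintegralB//; try exact: wZ.
rewrite -RintegralD//; try exact: wZ.
apply/andP; split; apply/eqP; apply: eq_Rintegral => t _.
  by case: (f t) => ? ? /=; ring.
by case: (f t) => ? ? /=; ring.
Qed.

Lemma wint_sum (I : Type) (r : seq I) (F : I -> R -> C) :
  (forall i, ccontinuous (F i)) ->
  wint (fun t => \sum_(i <- r) F i t) = \sum_(i <- r) wint (F i).
Proof.
move=> cF; elim: r => [|i r IH].
  rewrite big_nil wintE; under eq_Rintegral do rewrite big_nil mul0r.
  under [X in _ +i* X]eq_Rintegral do rewrite big_nil mul0r.
  by rewrite Rintegral_cst// mul0r.
under [in LHS]eq_fun do rewrite big_cons.
by rewrite big_cons wintD ?IH//; exact: ccontinuous_sum.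
Qed.

Lemma momentN k : moment (- k) = (moment k)^*.
Proof.
rewrite /moment !wintE; apply/eqP; rewrite eq_complex /=.
have ck := (ccontinuous_cis k).2.
rewrite -[X in _ && (_ == X)]mulN1r -RintegralZl//; last exact: wi.
apply/andP; split; apply/eqP; apply: eq_Rintegral => t _; rewrite rmorphN mulNr.
  by rewrite cosN.
by rewrite sinN mulNr mulN1r.
Qed.

(** On the circle the conjugate of z^j is z^(-j), so expanding both polynomials leaves moments of
    index i - j. This passes from integrals to the algebraic setting. *)
Lemma inner_uc_moment p q :
  inner_uc w (horner p) (horner q) = mip moment p q.
Proof.
have -> : inner_uc w (horner p) (horner q) =
    wint (fun t => \sum_(j < size q) (q`_j)^*
      * \sum_(i < size p) p`_i * cis (i%:Z - j%:Z) t).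
  rewrite /inner_uc /wint; congr cintegral; apply/funext => t; congr (_ * _).
  rewrite !horner_coef rmorph_sum mulrC mulr_suml; apply: eq_bigr => j _.
  rewrite !mulr_sumr; apply: eq_bigr => i _.
  by rewrite !expi_exp rmorphM /= -cisN cisD; ring.
have ct j i : ccontinuous (fun t => p`_i * cis (i%:Z - j%:Z) t).
  exact/ccontinuousZ/ccontinuous_cis.
rewrite wint_sum; last first.
  by move=> j; apply: ccontinuousZ; apply: ccontinuous_sum => i; exact: ct.
apply: eq_bigr => j _; rewrite wintZ; last first.
  by apply: ccontinuous_sum => i; exact: ct.
congr (_ * _); rewrite wint_sum; last by move=> i; exact: ct.
by apply: eq_bigr => i _; rewrite wintZ//; exact: ccontinuous_cis.
Qed.

End WeightMoments.

(** * Definiteness of the inner product *)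

Section Positivity.
Local Open Scope classical_set_scope.

(** On ]0, pi[ the angle is recovered from the real part of a root by [acos], so there are finitely
    many such angles. *)
Lemma negligible_expi_roots (R : realType) (p : {poly R[i]}) : p != 0 ->
  (@lebesgue_measure R).-negligible [set t | t \in `]0, pi[%R /\ root p (expi t)].
Proof.
move=> p0; apply/negligible_outer_measure;
apply: countable_lebesgue_measure0; apply: finite_set_countable.
have [s ps] := closed_field_poly_normal p.
apply: (@sub_finite_set _ _ [set` [seq acos (complex.Re z) | z <- s]]); last first.
  exact: finite_seq.
move=> t /= [t0pi]; rewrite ps rootZ ?lead_coef_eq0// root_prod_XsubC => ts.
apply/mapP; exists (expi t) => //=; rewrite cosK//.
by move: t0pi; rewrite !in_itv /= => /andP[? ?]; rewrite !ltW.
Qed.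

(** If the integral of |p|^2 w vanished, ]0, pi[ would be covered by the null set where the
    integrand is nonzero and the null set of roots of p. *)
Lemma inner_uc_neq0 (R : realType) (w : R -> R) (p : {poly R[i]}) :
  (forall g : R -> R, continuous g ->
    (@lebesgue_measure R).-integrable `[0, 2 * pi] (EFin \o (fun t => g t * w t))) ->
  (forall t, 0 <= w t) -> (forall t, t \in `]0, pi[%R -> 0 < w t) ->
  p != 0 -> inner_uc w (horner p) (horner p) != 0.
Proof.
move=> wi w0 wpos p0; apply/eqP => /(congr1 (@complex.Re R)) /=.
pose h t : R := complex.Re (p.[expi t]) ^+ 2 + complex.Im (p.[expi t]) ^+ 2.
have -> : (fun t => complex.Re (p.[expi t] * (p.[expi t])^* * (w t)%:C)) =
    (fun t => h t * w t).
  by apply/funext => t; rewrite /h; case: p.[expi t] => a b /=; ring.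
have ch : continuous h.
  have cp : ccontinuous (fun t => p.[expi t]).
    under eq_fun do rewrite horner_coef.
    apply: ccontinuous_sum => i; under eq_fun do rewrite expi_exp.
    exact/ccontinuousZ/ccontinuous_cis.
  by case: cp => c1 c2 t; apply: cvgD; apply: cvgM; (apply: c1 || apply: c2).
have hw0 t : 0 <= h t * w t by rewrite mulr_ge0 ?addr_ge0 ?sqr_ge0.
have hi := wi h ch; move: (hi) => /integrableP[mh _] I0.
have Ifin := @integrable_fin_num _ (measurableTypeR R) R _ _ (measurable_itv _) _ hi.
have {}I0 :
    (\int[@lebesgue_measure R]_(t in `[0%R, (2 * pi)%R]) `|(h t * w t)%R%:E| = 0)%E.
  transitivity (\int[@lebesgue_measure R]_(t in `[0%R, (2 * pi)%R]) (h t * w t)%R%:E)%E.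
    by apply: eq_integral => t _ /=; rewrite ger0_norm.
  by rewrite -(fineK Ifin); exact: (congr1 EFin I0).
move: I0 => /(@ae_eq_integral_abs _ (measurableTypeR R) R _ _ (measurable_itv _) _ mh) ae0.
have pi0 := pi_gt0 R.
have : (@lebesgue_measure R).-negligible `]0, pi[.
  apply: negligibleS (negligibleU ae0 (negligible_expi_roots p0)) => t /= t0pi.
  have [rt|nrt] := boolP (root p (expi t)); [by right|left => H].
  have tI : t \in `[0, 2 * pi]%R.
    by move: t0pi; rewrite !in_itv /= => /andP[? ?]; apply/andP; split; lra.
  have /eqP := H tI; rewrite eqe mulf_eq0 (gt_eqF (wpos _ t0pi)) orbF.
  rewrite /h paddr_eq0 ?sqr_ge0// !sqrf_eq0; move: nrt; rewrite rootE.
  by rewrite eq_complex => /negbTE ->.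
move/(@measure_negligible _ (measurableTypeR R) _ _ _ (measurable_itv _)) => m0.
have : @lebesgue_measure R `]0, pi[ = 0%E by exact: m0.
rewrite lebesgue_measure_itv /= lte_fin pi0 sube0 => /eqP.
by rewrite eqe gt_eqF.
Qed.

End Positivity.

(** * Moments of the Jacobi weight *)

Section JacobiMoments.
Local Open Scope classical_set_scope.
Variables (R : realType) (eta lambda beta : R).
Hypotheses (hlambda : - (1 / 2) < lambda) (hbeta : - (1 / 2) < beta).
Local Notation w := (jacobi_weight eta lambda beta).
Local Notation d := ((lambda + beta) +i* eta : R[i]).

Lemma moment_jacobi_weight_rec (k : int) :
  (k%:~R + 2 + d) * moment w (k + 2) + 2 * (lambda - beta)%:C * moment w (k + 1)
  + (d^* - k%:~R) * moment w k = 0.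
Proof.
have wi := integrable_continuous_mul_jacobi_weight eta hlambda hbeta.
have cc := @ccontinuous_cis R.
rewrite /moment -!(wintZ wi _ (cc _)).
have cZ a l := ccontinuousZ a (cc l).
rewrite -(wintD wi (cZ _ _) (cZ _ _)).
rewrite -(wintD wi (ccontinuousD (cZ _ _) (cZ _ _)) (cZ _ _)).
(* Since z^k (z^2 - 1) = 2 i z^(k+1) sin t, integration by parts is applied to cos(m t) and sin(m
   t), the two parts of z^(k+1). *)
pose m : R := (k + 1)%:~R.
have dsin (t : R) : is_derive t 1 (fun t : R => m * t) m.
  by apply: is_derive_eq; rewrite /GRing.scale /=; ring.
have dc (t : R) : is_derive t 1 (fun t => cos (m * t)) (- m * sin (m * t)).
  rewrite (_ : - m * _ = - sin (m * t) * m); last by ring.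
  exact: (@is_derive1_comp _ (@cos R) _ t _ _ (is_derive_cos _) (dsin t)).
have ds (t : R) : is_derive t 1 (fun t => sin (m * t)) (m * cos (m * t)).
  rewrite mulrC.
  exact: (@is_derive1_comp _ (@sin R) _ t _ _ (is_derive_sin _) (dsin t)).
have cdc : continuous (fun t => - m * sin (m * t)).
  by move=> t; apply: cvgM; [exact: cvg_cst|exact: is_derive_continuous (ds t)].
have cds : continuous (fun t => m * cos (m * t)).
  by move=> t; apply: cvgM; [exact: cvg_cst|exact: is_derive_continuous (dc t)].
have [cc' cs'] : continuous (fun t => cos (m * t)) /\ continuous (fun t => sin (m * t)).
  by split=> t; [exact: is_derive_continuous (dc t)|exact: is_derive_continuous (ds t)].
have Ec := Rintegral_jacobi_weight_by_parts eta hlambda hbeta dc cdc.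
have Es := Rintegral_jacobi_weight_by_parts eta hlambda hbeta ds cds.
(* Substituting 2 i sin t = z - 1/z and 2 cos t = z + 1/z in twice the complex integrand gives the
   three terms. *)
have E t : (k%:~R + 2 + d) * cis (k + 2) t + 2 * (lambda - beta)%:C * cis (k + 1) t
    + (d^* - k%:~R) * cis k t =
  (2 * (- m * sin (m * t) * sin t + cos (m * t) * (cos t - eta * sin t
    + (lambda - beta) + (lambda + beta) * cos t)))
  +i* (2 * (m * cos (m * t) * sin t + sin (m * t) * (cos t - eta * sin t
    + (lambda - beta) + (lambda + beta) * cos t))).
  have -> : k + 2 = k + 1 + 1 by lia.
  have -> : cis k t = cis (k + 1) t * (cis 1 t)^* by rewrite -cisN -cisD addrK.
  have -> : (k%:~R : R[i]) = m%:C - 1 by rewrite /m !rmorphD /= rmorph_int addrK.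
  rewrite cisD /cis mul1r -/m; apply/eqP; rewrite eq_complex /=.
  by apply/andP; split; apply/eqP; ring.
rewrite wintE; apply/eqP; rewrite eq_complex /=.
have I2 (g : R -> R) : continuous g -> Rintegral (@lebesgue_measure R) `[0, 2 * pi]
    (fun t => g t * w t) = 0 ->
    \int[@lebesgue_measure R]_(t in `[0, 2 * pi]) (2 * g t * w t) = 0.
  move=> cg I0; under eq_Rintegral do rewrite -mulrA.
  by rewrite RintegralZl ?I0 ?mulr0//; exact: wi.
under eq_Rintegral do rewrite E /=.
under [X in _ && (X == _)]eq_Rintegral do rewrite E /=.
by apply/andP; split; apply/eqP; apply: I2 => //; exact: continuous_parts_integrand.
Qed.

Lemma mip_moment_jacobi_weight_neq0 (p : {poly R[i]}) : p != 0 ->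
  mip (moment w) p p != 0.
Proof.
have wi := integrable_continuous_mul_jacobi_weight eta hlambda hbeta.
rewrite -(inner_uc_moment wi); apply: inner_uc_neq0 => // t.
  exact: jacobi_weight_ge0.
by rewrite in_itv /= => /sin_gt0_pi t0; rewrite jacobi_weight_gt0// gt_eqF.
Qed.

End JacobiMoments.

(** * The two differential equations for the Jacobi weight *)

Theorem corollary4p19 (R : realType) (eta lambda beta : R)
    (hlambda : - (1 / 2) < lambda) (hbeta : - (1 / 2) < beta)
    (Phi : nat -> {poly R[i]})
    (hPhi : is_monic_opuc (jacobi_weight eta lambda beta) Phi)
    (n : nat) (hn : (1 <= n)%N) :
  let d : R[i] := (lambda + beta) +i* eta in
  let alpha := verblunsky Phi in
  let ell (m k : nat) : R[i] := (Phi m)`_k in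
  let Phis : {poly R[i]} := revp n (Phi n) in
  (forall z : R[i],
    z * (z ^+ 2 - 1) * (Phi n)^`()^`().[z]
    + ((d + 3 - n%:R) * z ^+ 2 + 2 * (lambda - beta)%:C * z + d^* + n%:R - 1)
      * (Phi n)^`().[z]
    - (n%:R * (d + 2) * z - (d + n%:R + 1) * ell n.+1 n
       - 2 * n%:R * (beta - lambda)%:C) * (Phi n).[z]
    = - (d + n%:R + 1) * (alpha n)^* * Phis.[z])
  /\
  (forall z : R[i],
    z * (1 - z ^+ 2) * Phis^`()^`().[z]
    - ((d + 3 - n%:R) * z ^+ 2 + 2 * (lambda - beta)%:C * z + d^* + n%:R - 1)
      * Phis^`().[z]
    + (d * (n%:R - 2) * z - 2 * n%:R * (beta - lambda)%:C
       - (d + n%:R) * ell n n.-1 - (ell n.+1 n)^*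
       - (d^* + n%:R) * alpha n * (alpha n.-1)^*) * Phis.[z]
    = (2 * (d + n%:R) * alpha n.-1 * z + (d^* + n%:R + 1) * alpha n)
      * (Phi n).[z]).
Proof.
case: n hn => // n _ d alpha ell Phis.
have wi := integrable_continuous_mul_jacobi_weight eta hlambda hbeta.
have [hsize horth] := hPhi.
have size_P m : size (Phi m) = m.+1 by have [] := hsize m.
have monic_P m : Phi m \is monic by have [] := hsize m.
have orth_P m l : m != l ->
    mip (moment (jacobi_weight eta lambda beta)) (Phi m) (Phi l) = 0.
  by move=> ml; rewrite -(inner_uc_moment wi) horth.
have herm := momentN wi.
have pearson := moment_jacobi_weight_rec eta hlambda hbeta.
have pos := mip_moment_jacobi_weight_neq0 eta hlambda hbeta.
have horner_op p z : (pearson_op d (lambda - beta)%:C n.+1 p).[z] =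
    z * (z ^+ 2 - 1) * p^`()^`().[z] + ((d + 3 - n.+1%:R) * z ^+ 2
      + 2 * (lambda - beta)%:C * z + d^* + n.+1%:R - 1) * p^`().[z].
  rewrite /pearson_op -polyC1.
  rewrite !(hornerD, hornerN, hornerM, hornerZ, hornerXn, hornerX, hornerC).
  by rewrite !addrA.
(* The zeroth order coefficients are stated with beta - lambda, whereas [pearson_op] takes lambda -
   beta. *)
have lb : (beta - lambda)%:C = - (lambda - beta)%:C :> R[i].
  by rewrite -rmorphN opprB.
split=> z; rewrite lb.
  have := congr1 (fun p : {poly R[i]} => p.[z])
    (pearson_op_P herm pearson pos size_P monic_P orth_P n).
  rewrite hornerD (hornerD _ (- _)) hornerN !hornerZ horner_op hornerM hornerX => E.
  move: E; rewrite /alpha /ell /Phis /d !succnK => E.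
  by apply: etrans (etrans _ E) _; ring.
have := congr1 (fun p : {poly R[i]} => p.[z])
  (pearson_op_Ps herm pearson pos size_P monic_P orth_P n).
rewrite hornerD (hornerD (- _)) hornerN [in RHS]hornerD !hornerZ horner_op.
rewrite !hornerM !hornerX => E.
move: E; rewrite /alpha /ell /Phis /d !succnK => E.
by apply: etrans (etrans _ E) _; ring.
Qed.
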